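(* Let $A$ be a real $3\times 3$ symmetric matrix and let $S=\mathrm{tr}(A)I-A$, where $I$ is the $3\times 3$ identity matrix. Then $S$ is positive semidefinite if and only if $A$ has at most one negative eigenvalue, which, if it exists, is no larger in absolute value than the other two eigenvalues of $A$. Thus, $S$ is positive semidefinite if and only if $A$ is of maximal trace over rotation matrices.
   Context: A rotation matrix is a real orthogonal matrix of determinant one. A real $d\times d$ matrix $M$ is said to be of maximal trace over rotation matrices if $\mathrm{tr}(M)\geq \mathrm{tr}(UM)$ for every $d\times d$ rotation matrix $U$. Eigenvalues are counted with multiplicity. *)

(* Defs.v *)
From mathcomp Require Import all_boot all_order all_algebra.
From mathcomp Require Import polyrcf.
From mathcomp Require Export reals.

Set Implicit Arguments.
Unset Strict Implicit.
Unset Printing Implicit Defensive.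

Import Order.TTheory GRing.Theory Num.Theory.

Local Open Scope ring_scope.

(* The eigenvalues of A lying in R, as a list in which each eigenvalue is
   repeated according to its algebraic multiplicity. For symmetric A this
   accounts for all n eigenvalues of A. *)
Definition eigenvalues (R : rcfType) (n : nat) (A : 'M[R]_n) : seq R :=
  flatten [seq nseq (mup x (char_poly A)) x | x <- rootsR (char_poly A)].

Lemma count_mem_eigenvalues (R : rcfType) (n : nat) (A : 'M[R]_n) (x : R) :
  count_mem x (eigenvalues A) = mup x (char_poly A).
Proof.
have p0 : char_poly A != 0 by rewrite monic_neq0 ?char_poly_monic.
have xr : (x \in rootsR (char_poly A)) = root (char_poly A) x.
  by have := roots_on_rootsR p0 x; rewrite in_itv /= => <-.
have ur : uniq (rootsR (char_poly A)) by apply: uniq_roots.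
rewrite /eigenvalues count_flatten -map_comp.
rewrite (eq_map (g := fun y => ((y == x) * mup x (char_poly A))%N)); last first.
  by move=> y /=; rewrite count_nseq /=; case: eqP => // ->.
rewrite sumnE big_map -big_distrl /=.
have -> : (\sum_(y <- rootsR (char_poly A)) (y == x) =
    count_mem x (rootsR (char_poly A)))%N.
  by rewrite -sumn_count sumnE big_map.
rewrite count_uniq_mem // xr.
by case: (boolP (root _ _)) => [_|/mupNroot ->]; rewrite ?mul1n ?muln0.
Qed.

Lemma mem_eigenvalues (R : rcfType) (n : nat) (A : 'M[R]_n) (x : R) :
  (x \in eigenvalues A) = eigenvalue A x.
Proof.
rewrite -has_pred1 has_count count_mem_eigenvalues eigenvalue_root_char.
by rewrite -dvdp_XsubCl XsubC_dvd // monic_neq0 ?char_poly_monic.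
Qed.

Definition psdmx (R : realType) (n : nat) (M : 'M[R]_n) : Prop :=
  M^T = M /\ forall v : 'cV[R]_n, 0 <= (v^T *m M *m v) 0 0.

Definition rotmx (R : realType) (n : nat) (U : 'M[R]_n) : Prop :=
  U *m U^T = 1%:M /\ \det U = 1.

Definition max_trace_rotmx (R : realType) (n : nat) (M : 'M[R]_n) : Prop :=
  forall U : 'M[R]_n, rotmx U -> \tr (U *m M) <= \tr M.

(* Main.v *)
Require Import Defs.
From mathcomp Require Import all_boot all_order all_algebra.
From mathcomp Require Import ring lra spectral complex.
Import Order.TTheory GRing.Theory Num.Theory.
Local Open Scope ring_scope.

(** Two independent facts about S = tr(A) I - A are combined.

    Eigenvalues.  By the spectral theorem the quadratic form of a symmetric
    matrix is bounded above by c |v|^2 exactly when every eigenvalue is at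
    most c, so c I - A is positive semidefinite exactly then
    ([psdmx_scalar_sub]).  For a 3 x 3 matrix tr(A) is the sum of the three
    eigenvalues, hence x <= tr(A) says that the two eigenvalues other than x
    have a nonnegative sum.  That all pairs of entries of a list have a
    nonnegative sum is in turn the condition on signs and absolute values
    ([pairwise_add_ge0P]).

    Rotations.  For a rotation U by the angle t about the unit vector n, the
    matrix N = (1 - tr U) I + U + U^T equals 2 (1 - cos t) n n^T, and
    tr(N S) = 2 (tr A - tr(U A)) for symmetric A.  Therefore
    tr A - tr(U A) = (1 - cos t) n^T S n, which is nonnegative when S is
    positive semidefinite; conversely the half turns about all the axes
    recover every value n^T S n.  The axis n itself is never constructed:
    in the first direction it suffices that N is symmetric and satisfies
    N^2 = (3 - tr U) N ([axis_mx_sqr]), a consequence of the Cayley-Hamilton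
    identity. *)

(** * Spectrum of a real symmetric matrix *)

Lemma char_poly_conj (F : fieldType) n (P A : 'M[F]_n) : P \in unitmx ->
  char_poly (invmx P *m A *m P) = char_poly A.
Proof.
move=> Pu; pose Q := map_mx polyC P; pose Q' := map_mx polyC (invmx P).
have Q'Q : Q' *m Q = 1%:M by rewrite -map_mxM mulVmx // map_mx1.
rewrite /char_poly.
have -> : char_poly_mx (invmx P *m A *m P) = Q' *m char_poly_mx A *m Q.
  rewrite /char_poly_mx mulmxBr mulmxBl !map_mxM -/Q -/Q'.
  by rewrite scalar_mxC -(mulmxA 'X%:M) Q'Q mulmx1.
by rewrite !det_mulmx mulrAC -det_mulmx Q'Q det1 mul1r.
Qed.

(** The spectral theorem over the complex numbers R[i] applies to the
    complexified matrix B, which is Hermitian with a real spectral diagonal d.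
    Both conclusions then descend to R: the characteristic polynomial because
    embedding R in R[i] is injective on polynomials, the bound because in the
    coordinates y of v in the eigenbasis both sides are sums of the
    |y_i|^2, weighted by d_i and by c. *)
Lemma symmetric_spectrum (R : rcfType) n (A : 'M[R]_n) : A^T = A ->
  exists2 s : seq R, char_poly A = \prod_(x <- s) ('X - x%:P) &
    forall (c : R) (v : 'cV[R]_n), {in s, forall x, x <= c} ->
      (v^T *m A *m v) 0 0 <= c * (v^T *m v) 0 0.
Proof.
move=> symA; pose f : {rmorphism R -> R[i]} := real_complex R.
pose B := map_mx f A.
have Breal m p (M : 'M[R]_(m, p)) : map_mx f M \is a mxOver Num.real.
  by apply/mxOverP => i j; rewrite mxE complex_real.
have Bherm : B \is hermsymmx.
  apply: realsym_hermsym; last exact: Breal.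
  by apply/is_hermitianmxP; rewrite expr0 scale1r map_mx_id // /B map_trmx symA.
have /orthomx_spectralP := hermitian_normalmx Bherm.
set P := spectralmx B; set d := spectral_diag B => BE.
have Pu : P \is unitarymx := spectral_unitarymx B.
have dreal i : d 0 i = f (complex.Re (d 0 i)).
  by rewrite [RHS]RRe_real //; apply: (mxOverP (hermitian_spectral_diag_real Bherm)).
exists [seq complex.Re (d 0 i) | i <- enum 'I_n].
  apply: (@map_poly_inj _ _ f).
  rewrite map_char_poly -/B {1}BE char_poly_conj ?unitarymx_unit //.
  rewrite char_poly_trig ?diag_mx_is_trig // big_map big_enum /= rmorph_prod.
  apply: eq_bigr => i _.
  by rewrite rmorphB /= map_polyX map_polyC /= -/f -dreal mxE eqxx mulr1n.
move=> c v sc; rewrite -subr_ge0.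
pose y := P *m map_mx f v.
have yE : (map_mx f v)^T *m invmx P = (map_mx Num.conj y)^T.
  rewrite invmx_unitary // /y map_mxM trmx_mul; congr (_ *m _).
    by rewrite realmxC // Breal.
  by rewrite map_trmx.
have eA : f ((v^T *m A *m v) 0 0) = \sum_i d 0 i * `|y i 0| ^+ 2.
  have -> : f ((v^T *m A *m v) 0 0) = map_mx f (v^T *m A *m v) 0 0 by rewrite [RHS]mxE.
  rewrite !map_mxM -/B BE !mulmxA -map_trmx yE -mulmxA -/y mxE.
  apply: eq_bigr => i _; rewrite mul_mx_diag !mxE normCK; ring.
have e1 : f ((v^T *m v) 0 0) = \sum_i `|y i 0| ^+ 2.
  have -> : f ((v^T *m v) 0 0) = map_mx f (v^T *m v) 0 0 by rewrite [RHS]mxE.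
  rewrite !map_mxM -[X in X *m _]mulmx1 -(mulVmx (unitarymx_unit Pu)).
  rewrite !mulmxA -map_trmx yE -mulmxA -/y mxE.
  apply: eq_bigr => i _; rewrite !mxE normCK; ring.
rewrite -ler0c.
rewrite [X in _ <= X](_ : _ = f (c * (v^T *m v) 0 0 - (v^T *m A *m v) 0 0)) //.
rewrite rmorphB rmorphM eA e1 mulr_sumr -sumrB sumr_ge0 // => i _.
rewrite -mulrBl mulr_ge0 ?exprn_ge0 // dreal subr_ge0 lecR.
by apply: sc; apply/mapP; exists i; rewrite ?mem_enum.
Qed.

Lemma perm_eigenvalues (R : rcfType) n (A : 'M[R]_n) (s : seq R) :
  char_poly A = \prod_(x <- s) ('X - x%:P) -> perm_eq (eigenvalues A) s.
Proof.
move=> cA; apply/allP => x _ /=; rewrite count_mem_eigenvalues {}cA.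
apply/eqP; elim: s => [|y s IHs]; first by rewrite big_nil mupNroot ?root1.
rewrite big_cons mupM ?polyXsubC_eq0 ?monic_neq0 ?monic_prod_XsubC //= IHs.
by rewrite -['X - y%:P]expr1 mup_XsubCX; case: eqP.
Qed.

(** Both sides are, up to sign, the second highest coefficient of the
    characteristic polynomial. *)
Lemma sum_eigenvalues (R : rcfType) n (A : 'M[R]_n) (s : seq R) :
  char_poly A = \prod_(x <- s) ('X - x%:P) -> \tr A = \sum_(x <- s) x.
Proof.
move=> cA; have := size_char_poly A; rewrite cA size_prod_XsubC => -[sn].
case: n A cA sn => [|n] A cA sn.
  by rewrite (size0nil sn) big_nil /mxtrace big_ord0.
apply: oppr_inj; rewrite -char_poly_trace // cA -[X in X.-1]sn.
by rewrite coefPn_prod_XsubC ?sn.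
Qed.

(** * Lists with nonnegative pairwise sums *)

(** Comparing each entry with the rest of the list, whatever its position, makes
    the condition independent of the order of the entries. *)
Lemma pairwise_symP (T : eqType) (r : rel T) (s : seq T) : symmetric r ->
  pairwise r s <-> {in s, forall x, {in rem x s, forall y, r x y}}.
Proof.
move=> rsym; elim: s => [|a s IHs]; first by split=> // _ x.
rewrite pairwise_cons; split=> [/andP[/allP ra /IHs rs] x | rs].
  rewrite inE /= eq_sym; case: eqVneq => [<- _ //|_ /= xs y].
  by rewrite inE => /orP[/eqP-> |/rs]; [rewrite rsym ra | apply].
apply/andP; split.
  by apply/allP; have := rs a (mem_head a s); rewrite /= eqxx.
apply/IHs => x xs y yx; apply: rs; first by rewrite inE xs orbT.
by rewrite /=; case: eqP => _; rewrite ?inE ?yx ?orbT // (mem_rem yx).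
Qed.

(** A negative entry x forces every other entry y to satisfy y >= - x > 0;
    this gives both that x is the only negative entry and that it is the
    smallest in absolute value. *)
Lemma pairwise_add_ge0P (R : realDomainType) (s : seq R) :
  pairwise (fun x y => 0 <= x + y) s <->
  (count (fun x : R => (x < 0)%R) s <= 1)%N /\
  (forall x : R, x \in s -> x < 0 -> forall y : R, y \in rem x s -> `|x| <= `|y|).
Proof.
rewrite pairwise_symP; last by move=> x y; rewrite addrC.
have count_rem x : x \in s -> x < 0 ->
    (count (fun x : R => (x < 0)%R) s <= 1)%N = ~~ has (fun x => x < 0) (rem x s).
  move=> xs x0; rewrite (permP (perm_to_rem xs)) /= x0 has_count -leqNgt.
  by rewrite add1n ltnS.
split=> [sum_ge0 | [neg1 min_neg] x xs y yx].
  split=> [|x xs x0 y yx].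
    have [/hasP[x xs x0]|] := boolP (has (fun x => x < 0) s); last first.
      by rewrite has_count -leqNgt => /leq_trans ->.
    rewrite (count_rem x) //; apply/hasPn => y yx.
    have := sum_ge0 x xs y yx; rewrite -leNgt; lra.
  have xy := sum_ge0 x xs y yx.
  rewrite ltr0_norm // ger0_norm; lra.
have [x0|x0] := ltP x 0.
  have := min_neg x xs x0 y yx; move: neg1; rewrite (count_rem x) //.
  move/hasPn => /(_ y yx); rewrite -leNgt => y0.
  rewrite ltr0_norm // ger0_norm //; lra.
have [y0|y0] := ltP y 0; last by rewrite addr_ge0.
(* Now x is nonnegative and y negative, so y takes the role of x. *)
have xy : x \in rem y s.
  by apply: rem_mem => //; apply: contraTneq y0 => <-; rewrite -leNgt.
have := min_neg y (mem_rem yx) y0 x xy.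
rewrite ltr0_norm // ger0_norm //; lra.
Qed.

(** * Semidefiniteness and eigenvalues *)

Lemma symmetric_eigenvalues (R : rcfType) n (A : 'M[R]_n) : A^T = A ->
  char_poly A = \prod_(x <- eigenvalues A) ('X - x%:P) /\
  forall (c : R) (v : 'cV[R]_n), {in eigenvalues A, forall x, x <= c} ->
    (v^T *m A *m v) 0 0 <= c * (v^T *m v) 0 0.
Proof.
move=> /symmetric_spectrum[s cA rayleigh]; have es := perm_eigenvalues _ _ _ _ cA.
split=> [|c v lec]; first by rewrite (perm_big _ es).
by apply: rayleigh => x xs; apply: lec; rewrite (perm_mem es).
Qed.

Lemma dotv_gt0 (R : realDomainType) n (v : 'cV[R]_n) :
  v != 0 -> 0 < (v^T *m v) 0 0.
Proof.
move=> v0; have sq_ge0 i : 0 <= v^T 0 i * v i 0 by rewrite mxE -expr2 sqr_ge0.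
rewrite lt_neqAle eq_sym mxE sumr_ge0 // andbT; apply: contraNneq v0 => /eqP.
rewrite psumr_eq0 // => /allP /= z; apply/eqP/colP => i.
by have := z i (mem_index_enum i); rewrite !mxE -expr2 sqrf_eq0 => /eqP.
Qed.

Lemma quad_scalar_sub (R : comNzRingType) n (A : 'M[R]_n) (c : R) (v : 'cV[R]_n) :
  (v^T *m (c%:M - A) *m v) 0 0 = c * (v^T *m v) 0 0 - (v^T *m A *m v) 0 0.
Proof. by rewrite mulmxBr mulmxBl mul_mx_scalar -scalemxAl !mxE. Qed.

(** If x is an eigenvalue, the quadratic form of c I - A takes the value
    (c - x) |u|^2 at an eigenvector u; the converse is the bound on the quadratic
    form of A given by the spectral theorem. *)
Lemma psdmx_scalar_sub (R : realType) n (A : 'M[R]_n) (c : R) : A^T = A ->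
  psdmx (c%:M - A) <-> {in eigenvalues A, forall x, x <= c}.
Proof.
move=> symA; split=> [[_ psdS] x | lec].
  rewrite mem_eigenvalues => /eigenvalueP[u uA u0].
  have := psdS u^T; rewrite quad_scalar_sub trmxK uA -scalemxAl [X in _ - X]mxE -mulrBl.
  rewrite pmulr_lge0 ?subr_ge0 // -{1}(trmxK u); apply: dotv_gt0.
  by rewrite trmx_eq0.
split=> [|v]; first by rewrite linearB /= tr_scalar_mx symA.
by rewrite quad_scalar_sub subr_ge0; apply: (proj2 (symmetric_eigenvalues _ _ _ symA)).
Qed.

(** * Rotations of three-dimensional space *)

(** This is the Cayley-Hamilton theorem divided by M: the trace of the adjugate
    is the middle coefficient of the characteristic polynomial, and the adjugate
    stands for det(M) / M. *)
Lemma sqr_mx3_adj (R : comNzRingType) (M : 'M[R]_3) :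
  M *m M = \tr M *: M - (\tr (\adj M))%:M + \adj M.
Proof.
(* Entries indexed by plain naturals: the nested lifts produced by the two
   cofactor expansions then compute to numerals. *)
pose m i j := M (inord i) (inord j).
have Mm (i j : 'I_3) : M i j = m i j by rewrite /m !inord_val.
apply/matrixP => i j.
rewrite /mxtrace !mxE !big_ord_recl !big_ord0 !mxE /cofactor.
rewrite !(expand_det_row _ 0) !big_ord_recl !big_ord0 /cofactor !det_mx11 !mxE.
rewrite !Mm; move: m {Mm} => m.
case: i => [[|[|[]]]] // ?; case: j => [[|[|[]]]] // ?; rewrite /= /bump /=.
all: ring.
Qed.

(** The matrix is twice the orthogonal projection on the line of v, minus the
    identity: the half turn about v.  Its eigenvalues are 1, -1, -1. *)
Lemma det_half_turn (R : fieldType) (v : 'cV[R]_3) : let c := (v^T *m v) 0 0 in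
  c != 0 -> \det ((2 / c) *: (v *m v^T) - 1%:M) = 1.
Proof.
move=> c; pose x i := v (inord i) 0.
have vx (i : 'I_3) j : v i j = x i by rewrite /x inord_val ord1.
have -> : c = x 0%N ^+2 + x 1%N ^+2 + x 2%N ^+2.
  by rewrite /c !mxE !big_ord_recl !big_ord0 !mxE !vx /= /bump /=; ring.
move=> c0.
rewrite (expand_det_row _ 0) !big_ord_recl !big_ord0 /cofactor.
rewrite !(expand_det_row _ 0) !big_ord_recl !big_ord0 /cofactor !det_mx11 !mxE.
rewrite !big_ord_recl !big_ord0 !mxE !vx /= /bump /=.
move: x c0 {vx} => x c0; field.
exact: c0.
Qed.

Lemma trace_conj_psdmx_ge0 (R : realType) n p (S : 'M[R]_n) (B : 'M[R]_(n, p)) :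
  psdmx S -> 0 <= \tr (B^T *m S *m B).
Proof.
move=> [_ S0]; apply: sumr_ge0 => j _.
have -> : (B^T *m S *m B) j j = ((col j B)^T *m S *m col j B) 0 0; last exact: S0.
by rewrite tr_col -row_mul !mxE; apply: eq_bigr => k _; rewrite !mxE.
Qed.

(** For a rotation by the angle t about a unit vector n this is
    2 (1 - cos t) n n^T, a multiple of the projection on the axis. *)
Definition axis_mx {R : nzRingType} (U : 'M[R]_3) : 'M[R]_3 :=
  (1 - \tr U)%:M + U + U^T.

(** Since the adjugate of U is its inverse U^T, the Cayley-Hamilton identity
    expresses U^2 through U, U^T and I, and likewise for U^T.  All products in
    the square then reduce to combinations of these three matrices. *)
Lemma axis_mx_sqr (R : realType) (U : 'M[R]_3) : rotmx U ->
  axis_mx U *m axis_mx U = (3 - \tr U) *: axis_mx U.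
Proof.
move=> [UUt detU]; have UtU := mulmx1C UUt.
have adjU : \adj U = U^T.
  by rewrite -[LHS]mul1mx -UtU -mulmxA mul_mx_adj detU mulmx1.
have sU : U *m U = \tr U *: U - (\tr U)%:M + U^T.
  by rewrite sqr_mx3_adj adjU mxtrace_tr.
have sUt : U^T *m U^T = \tr U *: U^T - (\tr U)%:M + U.
  by rewrite -trmx_mul sU !linearD linearN /= linearZ /= tr_scalar_mx trmxK.
rewrite /axis_mx !mulmxDl !mulmxDr !mul_scalar_mx !mul_mx_scalar.
rewrite UUt UtU sU sUt.
apply/matrixP => i j; rewrite !mxE; case: (i == j); rewrite ?mulr1n ?mulr0n; ring.
Qed.

Lemma trace_axis_mx_mul (R : comNzRingType) (A U : 'M[R]_3) : A^T = A ->
  \tr (axis_mx U *m ((\tr A)%:M - A)) = 2 * (\tr A - \tr (U *m A)).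
Proof.
move=> symA.
have e : \tr (U^T *m A) = \tr (U *m A).
  by rewrite -mxtrace_tr trmx_mul trmxK symA mxtrace_mulC.
rewrite mulmxBr mul_mx_scalar /axis_mx !mulmxDl mul_scalar_mx linearB /= mxtraceZ.
rewrite !mxtraceD mxtraceZ mxtrace_scalar mxtrace_tr e.
ring.
Qed.

(** The squared Frobenius norm of I - U is 2 (n - tr U), which is positive
    unless U = I. *)
Lemma trace_rotmx_lt (R : realType) n (U : 'M[R]_n) :
  rotmx U -> U = 1%:M \/ \tr U < n%:R.
Proof.
move=> [UUt _].
have e : \tr ((1%:M - U) *m (1%:M - U)^T) = 2 * (n%:R - \tr U).
  rewrite linearB /= trmx1 mulmxBl !mulmxBr !mul1mx mulmx1 UUt.
  by rewrite !linearB /= mxtrace_tr mxtrace1; ring.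
have [|ltn] := ltrP (\tr U) n%:R; first by right.
left; apply/esym/subr0_eq.
have s0 i j : 0 <= (1%:M - U) i j * (1%:M - U)^T j i.
  by rewrite [_^T _ _]mxE -expr2 sqr_ge0.
have t0 i : 0 <= ((1%:M - U) *m (1%:M - U)^T) i i.
  by rewrite mxE sumr_ge0.
have : \tr ((1%:M - U) *m (1%:M - U)^T) == 0.
  rewrite eq_le sumr_ge0 // andbT e; lra.
rewrite psumr_eq0 // => /allP /= z; apply/matrixP => i j.
have := z i (mem_index_enum i); rewrite mxE psumr_eq0 //.
move=> /allP /(_ j (mem_index_enum j)) /=.
by rewrite [_^T _ _]mxE -expr2 sqrf_eq0 => /eqP ->; rewrite [RHS]mxE.
Qed.

(** By [trace_axis_mx_mul] the loss of trace under U is half of tr(N S) with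
    N = axis_mx U.  Unless U = I, N is a positive multiple of N^T N, which turns
    tr(N S) into a sum of values of the quadratic form of S.  Conversely, a half
    turn about v tests S at the vector v. *)
Lemma psdmx_max_trace_rotmx (R : realType) (A : 'M[R]_3) : A^T = A ->
  psdmx ((\tr A)%:M - A) <-> max_trace_rotmx A.
Proof.
move=> symA; set S := _ - A.
have symS : S^T = S by rewrite linearB /= tr_scalar_mx symA.
split=> [psdS U rotU | maxA].
  case: (trace_rotmx_lt _ _ _ rotU) => [->|tU]; first by rewrite mul1mx.
  have NN := axis_mx_sqr _ _ rotU.
  have := trace_axis_mx_mul _ A U symA; rewrite -/S => trNS.
  have symN : (axis_mx U)^T = axis_mx U.
    by rewrite !linearD /= trmxK tr_scalar_mx addrAC.
  (* With N = axis_mx U one has tr(N^T S N) = tr(N^2 S) = (3 - tr U) tr(N S),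
     and the factor 3 - tr U is positive as U is not the identity. *)
  have := trace_conj_psdmx_ge0 _ _ _ _ (axis_mx U) psdS.
  rewrite symN mxtrace_mulC mulmxA NN -scalemxAl linearZ /= trNS.
  by rewrite pmulr_rge0 ?subr_gt0 // pmulr_rge0 // subr_ge0.
split=> // v; pose c := (v^T *m v) 0 0.
have cE : v^T *m v = c%:M by rewrite [LHS]mx11_scalar.
have [->|v0] := eqVneq v 0; first by rewrite mulmx0 mxE.
have c_gt0 : 0 < c by exact: dotv_gt0.
have cn0 : c != 0 by rewrite gt_eqF.
(* For the half turn U about v, |v|^2 (tr A - tr(U A)) = 2 v^T S v. *)
pose U : 'M[R]_3 := (2 / c) *: (v *m v^T) - 1%:M.
have rotU : rotmx U.
  split; last exact: det_half_turn.
  have -> : U^T = U by rewrite linearB linearZ /= trmx_mul trmxK trmx1.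
  rewrite /U mulmxBl mul1mx mulmxBr mulmx1 -scalemxAl -scalemxAr.
  rewrite [v *m v^T *m _]mulmxA -[v *m v^T *m v]mulmxA cE mul_mx_scalar.
  rewrite -scalemxAl; apply/matrixP => i j; by rewrite !mxE; field.
have := maxA U rotU.
have -> : \tr (U *m A) = 2 / c * (v^T *m A *m v) 0 0 - \tr A.
  rewrite mulmxBl mul1mx linearB /= -scalemxAl linearZ /= -(mulmxA v) mxtrace_mulC.
  by rewrite trace_mx11.
set q := (v^T *m A *m v) 0 0.
rewrite quad_scalar_sub -/q -/c => maxU.
have -> : \tr A * c - q = c / 2 * (\tr A - (2 / c * q - \tr A)) by field.
by rewrite pmulr_rge0 ?divr_gt0 // subr_ge0.
Qed.

Theorem proposition8 (R : realType) (A : 'M[R]_3) (hA : A^T = A) :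
  let S : 'M[R]_3 := (\tr A)%:M - A in
  (psdmx S <->
     (count (fun x : R => (x < 0)%R) (eigenvalues A) <= 1)%N /\
     (forall x : R, x \in eigenvalues A -> x < 0 ->
        forall y : R, y \in rem x (eigenvalues A) -> `|x| <= `|y|)) /\
  (psdmx S <-> max_trace_rotmx A).
Proof.
move=> S; split; last exact: psdmx_max_trace_rotmx.
rewrite psdmx_scalar_sub // -pairwise_add_ge0P.
have [cA _] := symmetric_eigenvalues _ _ _ hA.
rewrite (sum_eigenvalues _ _ _ _ cA).
have := size_char_poly A; rewrite cA size_prod_XsubC => -[].
case: (eigenvalues A) => [|a [|b [|c []]]] //= _.
rewrite !big_cons big_nil addr0 !andbT; split=> [lec | /andP[/andP[ab ac] bc] x].
  have := lec a; have := lec b; have := lec c; rewrite !inE !eqxx ?orbT.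
  move=> /(_ isT) ? /(_ isT) ? /(_ isT) ?.
  apply/andP; split; [apply/andP; split|]; lra.
by rewrite !inE => /or3P[] /eqP->; lra.
Qed.
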